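(* Let $p\in(0,1)$, $q:=1-p$, $p\neq q$, and let $\{S_n\}_{n\ge 0}$ be the one-dimensional asymmetric simple random walk started from $S_0=0$ with $\mathbf{P}(S_{n+1}-S_n=1)=p$ and $\mathbf{P}(S_{n+1}-S_n=-1)=q$. Let $\mathcal{K}(n)$ denote its set of favorite sites at time $n$. Then for every fixed integer $r\ge 1$, $$\mathbf{P}\big(\#\mathcal{K}(n)=r \text{ for infinitely many } n\big)=1 .$$
   Context: Let $X_1,X_2,\ldots$ be i.i.d. with $\mathbf{P}(X_1=1)=p$, $\mathbf{P}(X_1=-1)=q=1-p$, and $S_0=0$, $S_n=X_1+\cdots+X_n$ for $n\ge1$. For $z\in\mathbb{Z}$ and $n\ge 1$, the local time at $z$ up to time $n$ is $\xi(z,n):=\#\{k: 0<k\le n,\ S_k=z\}$, and $\xi(n):=\max_{y\in\mathbb{Z}}\xi(y,n)$. The set of favorite sites at time $n$ is $\mathcal{K}(n):=\{z\in\mathbb{Z}: \xi(z,n)=\xi(n)\}$. Here $\#D$ denotes the cardinality of $D$. *)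

(* Defs.v *)
From HB Require Import structures.
From mathcomp Require Import all_boot all_order all_algebra finmap.
From mathcomp Require Import all_classical all_reals all_analysis.

Set Implicit Arguments.
Unset Strict Implicit.
Unset Printing Implicit Defensive.

Import Order.TTheory GRing.Theory Num.Theory.

Local Open Scope classical_set_scope.
Local Open Scope ring_scope.

Definition mutually_independent (d : measure_display) (T : measurableType d)
    (R : realType) (P : probability T R) (I : choiceType)
    (X : I -> {RV P >-> R}) : Prop :=
  forall (J : {fset I}) (B : I -> set R), (forall i, measurable (B i)) ->
    P (\bigcap_(i in [set` J]) (X i @^-1` B i)) =
      (\prod_(i <- J) P (X i @^-1` B i))%E.
Arguments mutually_independent {d T R} P {I} X.

(* A sequence of steps is indexed from 0: [x k] is the step from time k to
   time k + 1. *)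
Definition walk (R : realType) (x : nat -> R) (n : nat) : R :=
  \sum_(0 <= k < n) x k.

(* The times counted are 1, ..., n: time 0 does not contribute. *)
Definition local_time (R : realType) (x : nat -> R) (z : int) (n : nat) : nat :=
  count (fun k => walk x k == z%:~R) (iota 1 n).

Definition local_time_value (R : realType) (x : nat -> R) (n : nat) : pred nat :=
  fun m => `[< exists y : int, local_time x y n = m >].

Lemma local_time_value_ex (R : realType) (x : nat -> R) (n : nat) :
  exists m, local_time_value x n m.
Proof. by exists (local_time x 0 n); apply/asboolP; exists 0. Qed.

Lemma local_time_value_le (R : realType) (x : nat -> R) (n m : nat) :
  local_time_value x n m -> (m <= n)%N.
Proof.
move=> /asboolP[y <-]; rewrite /local_time.
by rewrite (leq_trans (count_size _ _)) // size_iota.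
Qed.

(* The maximum over all sites y : int, which exists because local times at
   time n are bounded by n. *)
Definition max_local_time (R : realType) (x : nat -> R) (n : nat) : nat :=
  ex_maxn (local_time_value_ex x n) (@local_time_value_le R x n).

Definition favorite_sites (R : realType) (x : nat -> R) (n : nat) : set int :=
  [set z | local_time x z n = max_local_time x n].

(* Main.v *)
(** By symmetry let the drift be to the right, [p > 1/2]. Local times grow by one
    at a single site at each step, so if [r] sites have local time [L] while no
    site has more, then exactly [r] sites were favorite at an earlier time, which
    is at least [L]. It remains to see such ties at arbitrarily high levels [L].

    Call a passage from a new maximum [m] to [m + b] that avoids [m - 1] a block
    of length [b]. The local times in a block depend only on the steps in the
    block, hence [r] successive blocks with maximal local time exactly [L] yield
    [r] tied sites. Let [G L b] be the probability of completing a block with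
    maximal local time at least [L], and [c = 1 - q / p] that of never going
    below the starting point. On the one hand [G L b <= b (2 q)^(L - 1)]. On the
    other hand, cutting into [C] blocks shows that [G L b >= c / 4] implies
    [G L (C b) >= c / 2], for some [C] depending only on [p]. Choose [K] with
    [C (2 q)^K < 1]. If [G (L + K) b >= c / 4] held whenever [G L b >= c / 2] and
    [L] is large, then iterating would give [G (L + i K) (C^i b) >= c / 2] for
    all [i], against the first bound. So for some large [L] and some [b] the
    maximum lies in [[L, L + K)] with probability at least [c / 4], and one of
    these [K] values has probability at least [c / (4 K)].

    Thus every history is followed by a high tie with probability bounded below,
    and such ties occur almost surely. *)

Require Import Defs.
From HB Require Import structures.
From mathcomp Require Import all_boot all_order all_algebra finmap.
From mathcomp Require Import all_classical all_reals all_analysis.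
From mathcomp Require Import ring lra zify.

Set Implicit Arguments.
Unset Strict Implicit.
Unset Printing Implicit Defensive.

Import Order.TTheory GRing.Theory Num.Theory.

Local Open Scope classical_set_scope.
Local Open Scope ring_scope.
Local Open Scope card_scope.

(** * Histories of steps and their visit counts *)

Definition step (b : bool) : int := if b then 1 else -1.

(* Histories are lists of steps with the most recent step first. *)
Fixpoint pos (h : seq bool) : int :=
  if h is b :: h' then step b + pos h' else 0.

Fixpoint visits (z : int) (h : seq bool) : nat :=
  if h is _ :: h' then ((pos h == z) + visits z h')%N else 0%N.

(* Unlike [visits], [occ] also counts time 0. *)
Definition occ (z : int) (h : seq bool) : nat := ((z == 0) + visits z h)%N.

Lemma pos_cat w h : pos (w ++ h) = pos w + pos h.
Proof. by elim: w => [|b w IH] /=; rewrite ?add0r // IH addrA. Qed.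

Lemma visits_cat z w h :
  visits z (w ++ h) = (visits (z - pos h) w + visits z h)%N.
Proof.
elim: w => [//|b w IH]; rewrite cat_cons /= IH pos_cat addnA.
by rewrite -[in RHS](can2_eq (addrK (pos h)) (subrK (pos h))) addrA.
Qed.

Lemma occ_cons z b h : occ z (b :: h) = ((pos (b :: h) == z) + occ z h)%N.
Proof. by rewrite /occ /= addnCA. Qed.

Lemma occ_pos h : (0 < occ (pos h) h)%N.
Proof. by case: h => [|b h]; [|rewrite occ_cons eqxx]. Qed.

Lemma visits_le_size z h : (visits z h <= size h)%N.
Proof. by elim: h => //= b h IH; case: eqP => _ /=; lia. Qed.

(** Time 0 of [w] is the last time of [h], so the visit that [occ] adds for [w] is one already
    counted for [h], at [pos h]. *)
Lemma occ_cat_ge z w h : (occ z w <= occ (z + pos h) (w ++ h))%N.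
Proof.
rewrite {2}/occ visits_cat addrK addnCA /occ addnC leq_add2l.
by case: eqP => [->|//]; rewrite add0r; exact: occ_pos.
Qed.

(** * Stopped expectations with a finite horizon *)

Section Value.
Variables (R : archiRealFieldType) (p : R).
Hypotheses (p0 : 0 < p) (p1 : p < 1).

(* The expected value of [f] at the first history in [D], counted as [0] when
   [D] is not reached within [n] further steps. *)
Fixpoint value n (D : pred (seq bool)) (f : seq bool -> R) h : R :=
  if D h then f h else
  if n is m.+1 then
    p * value m D f (true :: h) + (1 - p) * value m D f (false :: h)
  else 0.

Lemma mix_le a b a' b' : a <= a' -> b <= b' ->
  p * a + (1 - p) * b <= p * a' + (1 - p) * b'.
Proof. by move=> ? ?; apply: lerD; rewrite ler_wpM2l // ?subr_ge0 ltW. Qed.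

Lemma mix_ge0 a b : 0 <= a -> 0 <= b -> 0 <= p * a + (1 - p) * b.
Proof. by move=> ? ?; rewrite addr_ge0 // mulr_ge0 // ?subr_ge0 ltW. Qed.

Lemma value_stop n (D : pred (seq bool)) f h : D h -> value n D f h = f h.
Proof. by case: n => /= [|n] ->. Qed.

(** Optional stopping for a supermartingale [g]. Nonnegativity before [D] is there because running
    out of steps counts as 0. *)
Lemma value_le_super (I : seq bool -> Prop) (D : pred (seq bool)) f g n h :
  I h ->
  (forall h b, I h -> ~~ D h -> I (b :: h)) ->
  (forall h, I h -> ~~ D h -> 0 <= g h) ->
  (forall h, I h -> D h -> f h <= g h) ->
  (forall h, I h -> ~~ D h ->
     p * g (true :: h) + (1 - p) * g (false :: h) <= g h) ->
  value n D f h <= g h.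
Proof.
move=> + I_step g0 fg g_super; elim: n h => [|n IH] h Ih /=; case: ifPn => Dh.
- exact: fg.
- exact: g0.
- exact: fg.
- by apply: le_trans (g_super _ Ih Dh); apply: mix_le; apply/IH/I_step.
Qed.

Lemma value_mono (I : seq bool -> Prop) (D : pred (seq bool)) f g n h :
  I h ->
  (forall h b, I h -> ~~ D h -> I (b :: h)) ->
  (forall h, I h -> D h -> f h <= g h) ->
  value n D f h <= value n D g h.
Proof.
move=> + I_step fg; elim: n h => [|n IH] h Ih /=; case: ifPn => Dh //.
- exact: fg.
- exact: fg.
- by apply: mix_le; apply/IH/I_step.
Qed.

Lemma value_ge0 n D f h : (forall h, 0 <= f h) -> 0 <= value n D f h.
Proof.
move=> f0; elim: n h => [|n IH] h /=; case: ifP => // _.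
exact: mix_ge0.
Qed.

Lemma value_le1 n D f h : (forall h, f h <= 1) -> value n D f h <= 1.
Proof.
move=> f1; apply: (@value_le_super (fun _ => True) D f (fun=> 1)) => // *.
by rewrite !mulr1; lra.
Qed.

Lemma value_leS n D f h : (forall h, 0 <= f h) ->
  value n D f h <= value n.+1 D f h.
Proof.
move=> f0; elim: n h => [|n IH] h; rewrite [leRHS]/= [leLHS]/=;
  case: ifP => // _.
- by apply: mix_ge0; apply: (@value_ge0 0).
- by apply: mix_le.
Qed.

Lemma value_leD m n D f h : (forall h, 0 <= f h) ->
  value n D f h <= value (m + n) D f h.
Proof.
by move=> f0; elim: m => // m IH; rewrite addSn (le_trans IH)// value_leS.
Qed.

Lemma value_leq m n D f h : (forall h, 0 <= f h) -> (m <= n)%N ->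
  value m D f h <= value n D f h.
Proof. by move=> f0 /subnK <-; exact: value_leD. Qed.

Lemma valueB n D f g h :
  value n D (fun h => f h - g h) h = value n D f h - value n D g h.
Proof.
by elim: n h => [|n IH] h /=; case: ifP => // _; rewrite ?subr0// !IH; ring.
Qed.

Lemma eq_value n D f g h : f =1 g -> value n D f h = value n D g h.
Proof.
by move=> fg; elim: n h => [|n IH] h /=; case: ifP => // _; rewrite !IH.
Qed.

Lemma value_cat n (D : pred (seq bool)) f w h :
  value n D f (w ++ h) =
  value n (fun w => D (w ++ h)) (fun w => f (w ++ h)) w.
Proof.
by elim: n w => [|n IH] w //=; case: ifP => // _; rewrite -!cat_cons !IH.
Qed.

(** Strong Markov property at [D'], which is reached no later than [D]. The number of steps left
    then depends on the path, hence the bound for every [m]. *)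
Lemma value_le_markov (I : seq bool -> Prop) n (D D' : pred (seq bool)) f g h :
  I h ->
  (forall h b, I h -> ~~ D' h -> I (b :: h)) ->
  (forall h, D h -> D' h) ->
  (forall h m, I h -> D' h -> value m D f h <= g h) ->
  value n D f h <= value n D' g h.
Proof.
move=> + I_step DD' fg.
elim: n h => [|n IH] h Ih /=; case: (boolP (D' h)) => D'h.
- exact: (fg h 0%N).
- by case: ifPn => // /DD'; rewrite (negPf D'h).
- exact: (fg h n.+1).
- case: ifPn => [/DD'|_]; first by rewrite (negPf D'h).
  by apply: mix_le; apply/IH/I_step.
Qed.

Lemma valueZ n D a f h : value n D (fun h => a * f h) h = a * value n D f h.
Proof.
by elim: n h => [|n IH] h /=; case: ifP => // _; rewrite ?mulr0// !IH; ring.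
Qed.

Definition reach n (A : pred (seq bool)) h : R := value n A (fun=> 1) h.

Lemma reach_ge0 n A h : 0 <= reach n A h.
Proof. by apply: value_ge0. Qed.

Lemma reach_leq m n A h : (m <= n)%N -> reach m A h <= reach n A h.
Proof. by move=> mn; apply: value_leq. Qed.

Lemma value_le_reach n (D : pred (seq bool)) (A : pred (seq bool)) h :
  value n D (fun h => (A h)%:R) h <= reach n A h.
Proof.
elim: n h => [|n IH] h; rewrite /reach /=; case: ifP => //; case: ifP => //= _.
- by move=> _; apply: mix_ge0; exact: reach_ge0.
- by move=> _; rewrite -[leRHS](_ : p * 1 + (1 - p) * 1 = 1) ?mix_le ?value_le1 //
    => [h'|h'|]; rewrite ?lern1 ?leq_b1// !mulr1; lra.
- by move=> _; apply: mix_le.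
Qed.

(** The size condition restricts the second target to histories at most [n] steps longer than [h],
    so that a level beyond their length can be fixed in advance. *)
Lemma reach_trans n m (A A' : pred (seq bool)) (b : R) h : 0 <= b ->  b <= 1 ->
  (forall h', A h' -> (size h' <= n + size h)%N -> b <= reach m A' h') ->
  reach n A h * b <= reach (n + m) A' h.
Proof.
move=> b0 b1; elim: n h => [|n IH] h Ab.
  rewrite /reach [value 0 _ _ _]/=; case: ifP => Ah; rewrite ?mul1r ?mul0r.
    exact: Ab.
  exact: reach_ge0.
rewrite {1}/reach [value n.+1 _ _ _]/=; case: ifP => Ah.
  by rewrite mul1r (le_trans (Ab _ Ah _)) ?leq_addl// reach_leq ?leq_addl.
rewrite addSn /reach /=; case: ifP => A'h.
  apply: le_trans b1; rewrite -[leRHS]mul1r ler_wpM2r//.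
  rewrite -[leRHS](_ : p * 1 + (1 - p) * 1 = 1); last by rewrite !mulr1; lra.
  by apply: mix_le; exact: value_le1.
rewrite mulrDl -!mulrA; apply: mix_le; apply: IH => h' Ah' sh'; apply: Ab => //.
  by move: sh'; rewrite /= addnS addSn.
by move: sh'; rewrite /= addnS addSn.
Qed.

End Value.

(* (1 - d)^n (1 + n d) <= 1 by induction on n. *)
Lemma expr_le_eps (R : archiRealFieldType) (d e : R) : 0 < d -> d <= 1 -> 0 < e ->
  exists n, (1 - d) ^+ n <= e.
Proof.
move=> d0 d1 e0; have bern n : (1 - d) ^+ n * (1 + n%:R * d) <= 1.
  elim: n => [|n IH]; first by rewrite expr0; lra.
  apply: le_trans IH; rewrite exprSr -mulrA ler_wpM2l ?exprn_ge0 ?subr_ge0//.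
  rewrite -natr1; have : 0 <= n%:R :> R by [].
  by nra.
exists (Num.bound (e * d)^-1); set n := Num.bound _.
have ed0 : 0 < e * d by rewrite mulr_gt0.
have nb : (e * d)^-1 < n%:R by apply: archi_boundP; rewrite invr_ge0 ltW.
have nd : 1 < n%:R * (e * d) by rewrite -ltr_pdivrMr // div1r.
have y0 : 0 < 1 + n%:R * d by rewrite ltr_pwDl// mulr_ge0// ltW.
have := bern n; rewrite -ler_pdivlMr // => /le_trans; apply.
by rewrite ler_pdivrMr //; lra.
Qed.

(** * Blocks and the levels attained in them *)

Definition exit (b : nat) (h : seq bool) : bool := ~~ (0 <= pos h < b%:Z).

Definition high (L b : nat) (w : seq bool) : bool :=
  has (fun z : nat => (L <= occ z%:Z w)%N) (iota 0 b).

Lemma highP L b w :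
  reflect (exists2 z : nat, (z < b)%N & (L <= occ z%:Z w)%N) (high L b w).
Proof.
apply: (iffP hasP) => [[z]|[z zb Lz]]; first by rewrite mem_iota; exists z.
by exists z => //; rewrite mem_iota.
Qed.

Lemma high_cons L b s w : high L b w -> high L b (s :: w).
Proof.
move=> /highP[z zb Lz]; apply/highP; exists z => //.
by rewrite occ_cons (leq_trans Lz) ?leq_addl.
Qed.

Lemma high_leq L L' b w : (L <= L')%N -> high L' b w -> high L b w.
Proof.
by move=> LL' /highP[z zb Lz]; apply/highP; exists z => //; apply: leq_trans Lz.
Qed.

Lemma high_widen L b b' w : (b <= b')%N -> high L b w -> high L b' w.
Proof.
by move=> bb' /highP[z zb Lz]; apply/highP; exists z => //; apply: leq_trans bb'.
Qed.

Lemma high_cat L b c w h : pos h = c%:Z -> high L b w -> high L (b + c) (w ++ h).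
Proof.
move=> hc /highP[z zb Lz]; apply/highP; exists (z + c)%N; first by rewrite ltn_add2r.
by rewrite PoszD -hc (leq_trans Lz) ?occ_cat_ge.
Qed.

(** * Hitting, return and block probabilities for a drift to the right *)

Section Drift.
Variables (R : archiRealFieldType) (p : R).
Hypotheses (p_half : 1 < p + p) (p1 : p < 1).

Let p0 : 0 < p. Proof. by move: p_half p1; lra. Qed.

Local Notation value := (value p).

Definition drift_ratio : R := (1 - p) / p.

Lemma drift_ratio_gt0 : 0 < drift_ratio. Proof. by rewrite divr_gt0 ?subr_gt0. Qed.

Lemma drift_ratio_lt1 : drift_ratio < 1.
Proof. by rewrite ltr_pdivrMr //; move: p_half; lra. Qed.

Lemma mul_drift_ratio : p * drift_ratio = 1 - p.
Proof. by rewrite mulrC divfK ?gt_eqF. Qed.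

(* The probability that a walk starting from [y] ever hits 0. *)
Definition hit_prob (y : int) : R := if 0 <= y then drift_ratio ^ y else 1.

Lemma hit_prob0 : hit_prob 0 = 1. Proof. by []. Qed.
Lemma hit_prob1 : hit_prob 1 = drift_ratio. Proof. by []. Qed.

Lemma hit_prob_ge0 y : 0 <= hit_prob y.
Proof.
by rewrite /hit_prob; case: ifP => // _; rewrite exprz_ge0 ?ltW ?drift_ratio_gt0.
Qed.

Lemma hit_prob_neg y : y <= 0 -> hit_prob y = 1.
Proof.
by rewrite /hit_prob; case: ifP => // y0 y0'; rewrite (_ : y = 0) //; lia.
Qed.

(** With u = [drift_ratio], this is p u^2 + (1 - p) = u on the positive side; on the negative side
    [hit_prob] is constant up to 0. *)
Lemma hit_prob_harmonic y : y != 0 ->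
  p * hit_prob (y + 1) + (1 - p) * hit_prob (y - 1) = hit_prob y.
Proof.
move=> y0; have [yneg|ypos] : y < 0 \/ 0 < y by lia.
  by rewrite !hit_prob_neg; [ring|lia..].
rewrite /hit_prob (_ : 0 <= y + 1); last by lia.
rewrite (_ : 0 <= y - 1); last by lia.
rewrite (_ : 0 <= y); last by lia.
have un0 : drift_ratio != 0 by rewrite gt_eqF ?drift_ratio_gt0.
have [m ->] : exists m, y = m + 1 by exists (y - 1); lia.
rewrite addrK !expfzDr // expr1z -mul_drift_ratio; set v := drift_ratio ^ m.
have ratio_eq : p * drift_ratio + p = 1 by rewrite mul_drift_ratio subrK.
have -> : p * (v * drift_ratio * drift_ratio) + p * drift_ratio * v =
  (v * drift_ratio) * (p * drift_ratio + p) by ring.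
by rewrite ratio_eq mulr1.
Qed.

(** The walk avoids -1 forever with probability [1 - hit_prob (pos h + 1)]. The climb to [b] has
    mean duration (b - pos h) / (2 p - 1), and by Markov's inequality the last quotient bounds the
    probability that it takes more than [n] steps. *)
Lemma value_exit_ge n b h : -1 <= pos h <= b%:Z ->
  1 - hit_prob (pos h + 1) - (b%:Z - pos h)%:~R / ((p + p - 1) * n.+1%:R)
    <= value n (exit b) (fun h => (pos h == b%:Z)%:R) h.
Proof.
have d0 : 0 < p + p - 1 by move: p_half; lra.
elim: n h => [|n IH] h hb.
all: have t0 : 0 <= (b%:Z - pos h)%:~R :> R by rewrite ler0z; lia.
all: case: (boolP (exit b h)) => hD.
1,3: rewrite value_stop //; have [hb'|hb'] : pos h = b%:Z \/ pos h = -1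
  by move: hD; rewrite /exit; lia.
1,3: by rewrite hb' eqxx subrr mul0r subr0 gerBl hit_prob_ge0.
1,2: rewrite hb' addNr hit_prob0 subrr sub0r; apply: (@le_trans _ _ 0) => //.
1,2: by rewrite oppr_le0 divr_ge0 // -?hb' // mulr_ge0 // ltW.
- rewrite mulr1 /= (negPf hD) subr_le0.
  apply: (@le_trans _ _ 1); first by rewrite gerBl hit_prob_ge0.
  rewrite ler_pdivlMr // mul1r; have : 1 <= (b%:Z - pos h)%:~R :> R.
    by rewrite ler1z; move: hD; rewrite /exit; lia.
  by move: p1; lra.
set t := (_%:~R) in t0 *.
(* If the quotient exceeds 1, the claim is trivial. Otherwise the decrease of the mean distance by
   [p + p - 1] makes up for the shorter horizon. *)
have [tn|tn] := ltP ((p + p - 1) * n.+2%:R) t.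
  apply: (@le_trans _ _ 0); last exact: value_ge0.
  rewrite subr_le0; apply: (@le_trans _ _ 1); first by rewrite gerBl hit_prob_ge0.
  by rewrite ler_pdivlMr ?mul1r ?mulr_gt0// ltW.
rewrite /= (negPf hD).
have hI s : -1 <= pos (s :: h) <= b%:Z.
  by move: hD hb; rewrite /exit /=; case: s => /=; lia.
apply: le_trans (mix_le p0 p1 (IH _ (hI true)) (IH _ (hI false))).
rewrite /= -[hit_prob (pos h + 1)]hit_prob_harmonic; last first.
  by move: hD; rewrite /exit; lia.
have -> : 1 + pos h + 1 = pos h + 1 + 1 by lia.
have -> : -1 + pos h + 1 = pos h + 1 - 1 by lia.
have -> : (b%:Z - (1 + pos h))%:~R = t - 1 by rewrite /t !intrD; ring.
have -> : (b%:Z - (-1 + pos h))%:~R = t + 1 by rewrite /t !intrD; ring.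
suff : (t - (p + p - 1)) / ((p + p - 1) * n.+1%:R) <= t / ((p + p - 1) * n.+2%:R).
  set A := hit_prob _; set B := hit_prob _; set C := (_ * _)^-1; set E := (_ * _)^-1.
  by nra.
rewrite ler_pdivrMr ?mulr_gt0// mulrAC ler_pdivlMr ?mulr_gt0//.
have n0 : 0 <= n%:R :> R by [].
move: tn; rewrite -!natr1; set d := p + p - 1 in d0 *; set N := n%:R in n0 *.
by nra.
Qed.

Lemma value_exit_nil (b : nat) (e : R) : 0 < e ->
  exists n, 1 - drift_ratio - e <=
    value n (exit b) (fun h => (pos h == b%:Z)%:R) [::].
Proof.
move=> e0; have d0 : 0 < p + p - 1 by move: p_half; lra.
have ed0 : 0 < e * (p + p - 1) by rewrite mulr_gt0.
have [n hn] : exists n : nat, b%:R / (e * (p + p - 1)) < n%:R.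
  by eexists; apply: archi_boundP; rewrite divr_ge0 // ltW.
exists n; have b_ge0 : -1 <= pos [::] <= b%:Z by rewrite /=; lia.
apply: le_trans (value_exit_ge n b_ge0).
rewrite [pos [::]]/= add0r hit_prob1 subr0 lerD2l lerN2 -[_%:~R]/(b%:R).
rewrite ler_pdivrMr ?mulr_gt0// mulrA; move: hn; rewrite ltr_pdivrMr // => /ltW.
by move=> /le_trans; apply; rewrite mulrC ler_wpM2l ?ler_nat // ltW.
Qed.


(** A left step is followed by a sure return, a right step by one with probability [drift_ratio],
    and p * [drift_ratio] = 1 - p. *)
Definition return_prob : R := (1 - p) + (1 - p).

Lemma return_prob_gt0 : 0 < return_prob. Proof. by rewrite addr_gt0 ?subr_gt0. Qed.

Lemma return_prob_lt1 : return_prob < 1.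
Proof. by rewrite /return_prob; move: p_half; lra. Qed.

(* The probability, given the history [w], that [z] is ever visited for the
   [L]-th time; [return_prob] is the return probability. *)
Definition site_prob (L : nat) (z : int) (w : seq bool) : R :=
  if (L <= occ z w)%N then 1 else
  return_prob ^+ (L - occ z w).-1 *
    (if pos w == z then return_prob else hit_prob (pos w - z)).

Lemma site_prob_ge0 L z w : 0 <= site_prob L z w.
Proof.
rewrite /site_prob; case: ifP => // _; rewrite mulr_ge0//.
  exact/exprn_ge0/ltW/return_prob_gt0.
by case: ifP => _; [exact/ltW/return_prob_gt0|exact: hit_prob_ge0].
Qed.

(** If the step arrives at [z], one visit fewer is missing and the factor [return_prob] makes up for
    it, so one formula covers both cases. *)
Lemma site_prob_off L z w s : pos w != z -> (occ z w < L)%N ->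
  site_prob L z (s :: w) =
    return_prob ^+ (L - occ z w).-1 * hit_prob (pos (s :: w) - z).
Proof.
move=> wz wL; rewrite /site_prob occ_cons; case: eqP => [->|_].
  rewrite subrr hit_prob0 mulr1 add1n; case: leqP => Lk; last first.
    by rewrite -exprSr; congr (return_prob ^+ _); lia.
  by rewrite (_ : (L - occ z w).-1 = 0%N) //; lia.
by rewrite add0n leqNgt wL.
Qed.

Lemma site_prob_super L z w :
  p * site_prob L z (true :: w) + (1 - p) * site_prob L z (false :: w)
    <= site_prob L z w.
Proof.
have [Lk|kL] := leqP L (occ z w).
  have Ls s : site_prob L z (s :: w) = 1.
    by rewrite /site_prob occ_cons (leq_trans Lk) ?leq_addl.
  by rewrite !Ls /site_prob Lk !mulr1 subrKC.
have [wz|wz] := eqVneq (pos w) z.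
  have Es s : site_prob L z (s :: w) =
      return_prob ^+ (L - occ z w).-1 * hit_prob (step s).
    rewrite /site_prob occ_cons /= wz addrK.
    rewrite (_ : (step s + z == z) = false); last by case: s => /=; lia.
    by rewrite add0n leqNgt kL.
  rewrite !Es /site_prob leqNgt kL /= wz eqxx hit_prob1 hit_prob_neg // mulr1.
  rewrite mulrCA mul_drift_ratio [(1 - p) * _]mulrC -mulrDr.
  exact: lexx.
rewrite !site_prob_off // mulrCA [(1 - p) * _]mulrCA -mulrDr.
rewrite /site_prob leqNgt kL /= (negPf wz).
rewrite -[hit_prob (pos w - z)]hit_prob_harmonic ?subr_eq0//.
rewrite /= (_ : 1 + pos w - z = pos w - z + 1); last by lia.
by rewrite (_ : -1 + pos w - z = pos w - z - 1); last by lia.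
Qed.

(** The first visit is free: at 0 it is time 0, and sites to the right are hit surely. Each further
    visit costs a factor [return_prob]. *)
Lemma site_prob_nil L (z : nat) : site_prob L z%:Z [::] <= return_prob ^+ L.-1.
Proof.
have r0 := return_prob_gt0; have r1 := ltW return_prob_lt1.
rewrite /site_prob /occ /= addn0; case: leqP => [Lz|zL].
  by rewrite (_ : L.-1 = 0%N) //; case: eqP Lz => _ /=; lia.
case: (posnP z) zL => [->|z0] /= zL.
  by rewrite -exprSr subn1 (_ : L.-1.-1.+1 = L.-1) //; lia.
rewrite (_ : (Posz z == 0) = false); last by lia.
rewrite (_ : (0 == Posz z) = false); last by lia.
by rewrite subn0 hit_prob_neg ?mulr1//; lia.
Qed.

(* The probability that the walk started at 0 reaches [b] before -1 within
   [n] steps, after occupying some site at least [L] times. *)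
Definition block n L b : R :=
  value n (exit b) (fun w => ((pos w == b%:Z) && high L b w)%:R) [::].

(** Union bound over the [b] sites: the sum of the [site_prob] is a supermartingale that is at least
    1 where level [L] is attained. *)
Lemma block_le n L b : block n L b <= b%:R * return_prob ^+ L.-1.
Proof.
pose g w : R := \sum_(z <- iota 0 b) site_prob L z%:Z w.
have g0 w : 0 <= g w by apply: sumr_ge0 => z _; exact: site_prob_ge0.
apply: (@le_trans _ _ (g [::])).
  apply: (@value_le_super _ p p0 p1 (fun _ => True)) => //.
  - move=> h _ _; case: andP => [[_ /highP[z zb Lz]]|_] //.
    rewrite /g (bigD1_seq z) ?iota_uniq ?mem_iota//= /site_prob Lz lerDl.
    by apply: sumr_ge0 => y _; exact: site_prob_ge0.
  - move=> h _ _; rewrite !mulr_sumr -big_split /=; apply: ler_sum => z _.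
    exact: site_prob_super.
have -> : b%:R * return_prob ^+ L.-1 = \sum_(z <- iota 0 b) return_prob ^+ L.-1.
  by rewrite big_const_seq count_predT size_iota iter_addr_0 mulr_natl.
by apply: ler_sum => z _; exact: site_prob_nil.
Qed.

Lemma block_leq m n L b : (m <= n)%N -> block m L b <= block n L b.
Proof. by move=> mn; apply: value_leq. Qed.

(** Each stretch of length [b] begun at a new maximum attains level [L] with probability at least
    [d], whatever came before, so missing [L] costs a factor [1 - d] per stretch. *)
Lemma not_high_le n m0 j L b d : d <= block m0 L b -> d <= 1 ->
  value n (exit (j * b)%N)
    (fun w => ((pos w == (j * b)%N%:Z) && ~~ high L (j * b) w)%:R) [::]
  <= (1 - d) ^+ j.
Proof.
move=> dG d1; elim: j n => [|j IH] n.
  by rewrite expr0 value_le1 // => w; rewrite lern1 leq_b1.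
rewrite exprS; set B := (j * b)%N; set B' := (j.+1 * b)%N.
have B'E : B' = (b + B)%N by rewrite /B' mulSn.
apply: le_trans (ler_wpM2l _ (IH n)); last by rewrite subr_ge0.
rewrite -valueZ.
apply: (@value_le_markov _ p p0 p1 (fun h => -1 <= pos h <= B%:Z)).
- by rewrite /=; lia.
- by move=> h s; rewrite /exit /=; case: s => /=; lia.
- by move=> h; rewrite /exit; lia.
move=> h m hB hD; have [hneg|hpos] : pos h = -1 \/ pos h = B%:Z.
- by move: hD hB; rewrite /exit; lia.
- rewrite value_stop; last by rewrite /exit; lia.
  rewrite hneg [_ == _](_ : _ = false) /=; last by lia.
  by rewrite mulr_ge0 // subr_ge0.
have high0 k w : high L B' w ->
    value k (exit B') (fun w => ((pos w == B'%:Z) && ~~ high L B' w)%:R) w <= 0.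
  move=> hw; apply: (@value_le_super _ p p0 p1 (fun w => high L B' w)) => //.
  - by move=> v s hv _; exact: high_cons.
  - by move=> v hv _; rewrite hv andbF.
  - by move=> v _ _; rewrite !mulr0 addr0.
rewrite hpos eqxx /=; case: (boolP (high L B h)) => hh /=.
  rewrite mulr0; apply/high0/high_widen/hh; lia.
(* The extra [m0] steps give the next stretch time to succeed with probability [d]. After a failure,
   even a descent below its start, the trivial bound 1 is used. *)
rewrite mulr1; apply: le_trans (value_leD p0 p1 m0 _ _ _ _) _ => //.
rewrite -[h]cat0s value_cat.
apply: (@le_trans _ _ (value (m0 + m) (exit b)
  (fun w => 1 - ((pos w == b%:Z) && high L b w)%:R) [::])); last first.
  rewrite valueB lerB ?value_le1//; apply: le_trans dG _.
  by apply: block_leq; rewrite leq_addr.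
apply: (@value_le_markov _ p p0 p1 (fun=> True)) => //.
  by move=> w; rewrite /exit pos_cat hpos; lia.
move=> w k _ _; case: (boolP (_ && high L b w)) => [/andP[_ hw]|_].
  rewrite subrr; have := high0 k (w ++ h); rewrite value_cat; apply.
  by rewrite B'E; exact: high_cat.
by rewrite subr0 value_le1 // => v; rewrite lern1 leq_b1.
Qed.

(* Each of the [C] blocks of length [b] making up a block of length [C * b] is
   a new chance to reach level [L]. *)
Lemma block_amplify (d : R) : 0 < d -> d <= 1 ->
  exists2 C, (0 < C)%N & forall L b n, d <= block n L b ->
    exists n', (1 - drift_ratio) / 2 <= block n' L (C * b).
Proof.
move=> d0 d1; have u1 := drift_ratio_lt1; have u0 := drift_ratio_gt0.
(* One quarter of [1 - drift_ratio] is lost here and another to the finite horizon below, which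
   leaves half. *)
have [C dC] : exists C, (1 - d) ^+ C <= (1 - drift_ratio) / 4.
  by apply: expr_le_eps => //; lra.
exists C.+1 => // L b n dG; set B := (C.+1 * b)%N.
have e0 : 0 < (1 - drift_ratio) / 4 by lra.
have [n' h1] := value_exit_nil B e0; exists n'.
have h2 := @not_high_le n' n C.+1 L b d dG d1.
have h3 : (1 - d) ^+ C.+1 <= (1 - drift_ratio) / 4.
  by apply: le_trans dC; rewrite exprS ler_piMl ?exprn_ge0 ?subr_ge0 // gerBl ltW.
have -> : block n' L B =
    value n' (exit B) (fun w => (pos w == B%:Z)%:R) [::] -
    value n' (exit B) (fun w => ((pos w == B%:Z) && ~~ high L B w)%:R) [::].
  rewrite -valueB; apply: eq_value => w.
  by case: (_ == _); case: high => /=; rewrite ?subrr ?subr0.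
by move: h1 h2 h3; rewrite -/B; lra.
Qed.
End Drift.

(** * Ties built from successive blocks *)

Definition high_exactly (L b : nat) (w : seq bool) : bool :=
  high L b w && ~~ high L.+1 b w.

(* The walk has just reached a new maximum. *)
Definition fresh (h : seq bool) : Prop :=
  forall z : int, pos h <= z -> visits z h = (z == pos h) :> nat.

(** For [r = 0] only the bound by [L] remains; the construction of ties starts from there. *)
Definition tied (r L : nat) (h : seq bool) : Prop :=
  (forall z, (visits z h <= L)%N) /\
  exists s : seq int, [/\ uniq s, size s = r & {in s, forall z, visits z h = L}].

(* Apart from its current position, the walk has stayed in [[0, b)]. *)
Definition confined (b : nat) (w : seq bool) : Prop :=
  forall z : int, ~~ (0 <= z < b%:Z) -> (visits z w <= (z == pos w))%N.

Lemma confined_cons b w s : confined b w -> ~~ exit b w -> confined b (s :: w).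
Proof.
move=> cw; rewrite negbK => wb z zb; have := cw z zb.
rewrite (_ : (z == pos w) = false); last by apply/eqP => zw; rewrite zw wb in zb.
by rewrite leqn0 /= => /eqP ->; rewrite addn0 eq_sym.
Qed.

Lemma visits_far z h : (size h)%:Z < `|z| -> visits z h = 0%N.
Proof.
elim: h z => //= b h IH z zh.
have pos_size : forall h', `|pos h'| <= (size h')%:Z.
  by elim=> //= s h'; case: s => /=; lia.
rewrite IH; last by lia.
rewrite addn0; apply/eqP; rewrite eqb0; apply/eqP.
by have := pos_size (b :: h) => /=; lia.
Qed.

Lemma pos_ge h : - (size h)%:Z <= pos h.
Proof. by elim: h => //= b h; case: b => /=; lia. Qed.

Lemma fresh_cat b w h : (0 < b)%N -> confined b w -> pos w = b%:Z ->
  (forall z : int, b%:Z + pos h <= z -> visits z h = 0%N) -> fresh (w ++ h).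
Proof.
move=> b0 cw wb hb z; rewrite pos_cat wb => zb.
rewrite visits_cat hb // addn0.
have := cw (z - pos h); rewrite wb.
have -> : (z - pos h == b%:Z) = (z == b%:Z + pos h) by apply/eqP/eqP; lia.
move=> /(_ ltac:(lia)); case: eqP => [zE|_] /=; last by lia.
have := occ_pos w; rewrite /occ wb (_ : z - pos h = b%:Z); last by lia.
by rewrite (_ : (b%:Z == 0) = false); lia.
Qed.

(** The block leaves the counts below [pos h] unchanged, and from [pos h] on it alone determines
    them, as [occ] includes the visit that [h] made at [pos h]. Since [1 < L], the old tied sites
    lie below [pos h], so the new one is distinct. *)
Lemma tied_cat r L b w h : (1 < L)%N -> fresh h -> tied r L h ->
  confined b w -> pos w = b%:Z -> high_exactly L b w ->
  fresh (w ++ h) /\ tied r.+1 L (w ++ h).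
Proof.
move=> L1 fh [hL [s [us ss sL]]] cw wb /andP[/highP[y yb Ly] /highP ntop].
have b0 : (0 < b)%N by case: b yb {cw wb ntop}.
have occ_le (z : nat) : (z < b)%N -> (occ z%:Z w <= L)%N.
  by move=> zb; rewrite leqNgt; apply/negP => Lz; apply: ntop; exists z.
have below (z : int) : z < pos h -> visits z (w ++ h) = visits z h.
  move=> zh; rewrite visits_cat; have := cw (z - pos h) ltac:(lia).
  rewrite wb (_ : (z - pos h == b%:Z) = false); last by lia.
  by rewrite leqn0 => /eqP ->.
have above (z : int) : pos h <= z -> visits z (w ++ h) = occ (z - pos h) w.
  by move=> zh; rewrite visits_cat fh // addnC /occ subr_eq0.
have sh (z : int) : z \in s -> z < pos h.
  by move=> zs; rewrite ltNge; apply/negP => /fh; rewrite sL //; lia.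
split.
  by apply: (@fresh_cat b) => // z zb; rewrite fh; lia.
split=> [z|].
  have [zh|zh] := ltP z (pos h); first by rewrite below.
  rewrite above //; have [zb|zb] := ltP (z - pos h) b%:Z.
    rewrite -[z - pos h]gez0_abs; last by lia.
    by apply: occ_le; lia.
  have := cw (z - pos h) ltac:(lia); rewrite /occ.
  rewrite (_ : (z - pos h == 0) = false); last by lia.
  by case: eqP => _; lia.
exists (pos h + y%:Z :: s); split => /=.
- by rewrite us andbT; apply/negP => /sh; lia.
- by rewrite ss.
move=> z; rewrite inE => /orP[/eqP ->|zs]; last by rewrite below ?sL ?sh.
rewrite above; last by lia.
by apply/eqP; rewrite addrC addKr eqn_leq occ_le.
Qed.

(** * High ties have probability bounded below after every history *)

Section Ties.
Variables (R : archiRealFieldType) (p : R).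
Hypotheses (p_half : 1 < p + p) (p1 : p < 1).

Let p0 : 0 < p. Proof. by move: p_half p1; lra. Qed.

(** The walk may zigzag [L] times between 0 and 1 and then step to 2. *)
Lemma block_gt0 L : exists n, 0 < block p n L 2.
Proof.
pose f w : R := ((pos w == 2%:Z) && high L 2 w)%:R.
have f0 w : 0 <= f w by [].
have stepV n s h : ~~ exit 2 h -> 0 < value p n (exit 2) f (s :: h) ->
    0 < value p n.+1 (exit 2) f h.
  have q0 : 0 < 1 - p by rewrite subr_gt0.
  move=> /negPf hD; case: s => v0; rewrite /= hD.
    by apply: ltr_pwDl; [exact: mulr_gt0 | rewrite mulr_ge0 ?value_ge0 // ltW].
  by apply: ltr_wpDl; [rewrite mulr_ge0 ?value_ge0 // ltW | exact: mulr_gt0].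
suff zigzag k h : pos h = 0 -> (L <= occ 0 h + k)%N ->
    0 < value p (k.*2 + 2) (exit 2) f h.
  by exists (L.*2 + 2)%N; apply: zigzag; rewrite // leq_addl.
elim: k h => [|k IH] h h0 Lh.
  rewrite add0n; apply: (stepV _ true); first by rewrite /exit h0.
  apply: (stepV _ true); first by rewrite /exit /= h0.
  rewrite value_stop; last by rewrite /exit /= h0.
  rewrite /f [pos _]/= h0 [_ == _]/= (_ : high _ _ _) //.
  apply/high_cons/high_cons/highP; exists 0%N => //.
  by rewrite addn0 in Lh.
rewrite doubleS !addSn; apply: (stepV _ true); first by rewrite /exit h0.
apply: (stepV _ false); first by rewrite /exit /= h0.
apply: IH; first by rewrite /= h0.
by rewrite !occ_cons /= h0 -addnA; move: Lh; lia.
Qed.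

Lemma exact_level : exists2 c : R, 0 < c & forall L0, exists L b n,
  (L0 <= L)%N /\
  c <= value p n (exit b) (fun w => ((pos w == b%:Z) && high_exactly L b w)%:R) [::].
Proof.
have u1 := drift_ratio_lt1 p_half p1; have u0 := drift_ratio_gt0 p_half p1.
have r0 := return_prob_gt0 p1; have r1 := return_prob_lt1 p_half.
have [C C0 ampC] : exists2 C, (0 < C)%N & forall L b n,
    (1 - drift_ratio p) / 4 <= block p n L b ->
    exists n', (1 - drift_ratio p) / 2 <= block p n' L (C * b).
  by apply: block_amplify => //; lra.
have Cr0 : 0 < C%:R :> R by rewrite ltr0n.
(* Lengthening the block by the factor [C] and raising the level by [K + 1] then at least halves the
   bound of [block_le]. *)
have [K rhoK] : exists K, C%:R * return_prob p ^+ K.+1 <= 1 / 2.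
  have [||//|K hK] := @expr_le_eps R (1 - return_prob p) (1 / (2 * C%:R)).
  - by lra.
  - by lra.
  - by rewrite divr_gt0 ?mulr_gt0.
  exists K; rewrite -ler_pdivlMl //; apply: (@le_trans _ _ (return_prob p ^+ K)).
    by rewrite exprS ler_piMl ?exprn_ge0// ltW.
  by rewrite subKr in hK; apply: le_trans hK _; rewrite invfM; lra.
(* If each single level accounts for at most [c], then [K + 1] levels account for at most a quarter
   of [1 - drift_ratio]. *)
pose c : R := (1 - drift_ratio p) / 4 / K.+1%:R.
have c0 : 0 < c by rewrite !divr_gt0 //; lra.
exists c => // L0; apply: contrapT => notop.
have small L b n : (L0 <= L)%N ->
    block p n L b - block p n L.+1 b <= c.
  move=> L0L; rewrite leNgt; apply/negP => cE; apply: notop.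
  exists L, b, n; split=> //; rewrite (le_trans (ltW cE)) // -valueB.
  apply: (@value_mono _ p p0 p1 (fun=> True)) => // w _ _; rewrite /high_exactly.
  case: (_ == _); rewrite /= ?subr0 //; case: (boolP (high L.+1 b w)) => /= h1.
    by rewrite (high_leq _ h1) // subrr.
  by rewrite andbT subr0.
have iter_small L b n k : (L0 <= L)%N ->
    block p n L b - block p n (L + k) b <= k%:R * c.
  move=> L0L; elim: k => [|k IH]; first by rewrite addn0 subrr mul0r.
  have := small (L + k)%N b n (leq_trans L0L (leq_addr _ _)).
  by rewrite -natr1 mulrDl mul1r addnS; move: IH; lra.
have grow L b : (L0 <= L)%N ->
    (exists n, (1 - drift_ratio p) / 2 <= block p n L b) ->
    exists n, (1 - drift_ratio p) / 2 <= block p n (L + K.+1) (C * b).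
  move=> L0L [n hn]; apply: (ampC _ _ n).
  have := iter_small L b n K.+1 L0L.
  by rewrite /c mulrC divfK ?pnatr_eq0 //; move: hn; lra.
(* The iteration starts from an amplified block of length 2. The level [L0 + 1] absorbs the
   predecessor in the exponent of [block_le]. *)
have [b0 hb0] : exists b, exists n, (1 - drift_ratio p) / 2 <= block p n L0.+1 b.
  have [n n0] := block_gt0 L0.+1.
  have [|C' _ /(_ L0.+1 2%N n (lexx _)) C'h] := block_amplify p_half p1 n0.
    by apply: value_le1 => // w; rewrite lern1 leq_b1.
  by exists (C' * 2)%N.
have grows i : exists n,
    (1 - drift_ratio p) / 2 <= block p n (L0.+1 + i * K.+1) (C ^ i * b0).
  elim: i => [|i IH]; first by rewrite addn0 mul1n.
  rewrite mulSn (addnC K.+1) addnA expnS -mulnA; apply: grow => //.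
  by rewrite addSn leqW ?leq_addr.
(* For this [i] the bound of [block_le] is at most a quarter of [1 - drift_ratio], against the half
   given by [grows]. *)
have e0 : 0 < (1 - drift_ratio p) / 4 / b0.+1%:R by rewrite !divr_gt0 //; lra.
have [||i hi] := @expr_le_eps R (1 / 2) _ _ _ e0; [lra|lra|].
have [n] := grows i; apply/negP; rewrite -ltNge.
apply: le_lt_trans (block_le p_half p1 _ _ _) _.
rewrite natrM natrX addSn /= exprD mulnC exprM.
have x1 : return_prob p ^+ L0 <= 1 by rewrite exprn_ile1 // ltW.
have x0 : 0 <= return_prob p ^+ L0 by rewrite exprn_ge0 // ltW.
have y0 : 0 <= (C%:R * return_prob p ^+ K.+1) ^+ i.
  by rewrite exprn_ge0 // mulr_ge0 // exprn_ge0 // ltW.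
have y1 : (C%:R * return_prob p ^+ K.+1) ^+ i <= (1 / 2) ^+ i.
  rewrite lerXn2r ?nnegrE ?divr_ge0 //.
  by rewrite mulr_ge0 // exprn_ge0 // ltW.
have -> : C%:R ^+ i * b0%:R * (return_prob p ^+ L0 * (return_prob p ^+ K.+1) ^+ i) =
  b0%:R * ((C%:R * return_prob p ^+ K.+1) ^+ i * return_prob p ^+ L0).
  by rewrite exprMn; ring.
have hi' : (1 / 2) ^+ i <= (1 - drift_ratio p) / 4 / b0.+1%:R.
  by move: hi; rewrite (_ : 1 - 1 / 2 = 1 / 2); last by lra.
set y := (_ * _) ^+ i in y0 y1 *; set x := _ ^+ L0 in x0 x1 *.
apply: (@le_lt_trans _ _ (b0%:R * ((1 - drift_ratio p) / 4 / b0.+1%:R))).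
  rewrite ler_wpM2l //; apply: le_trans hi'; apply: le_trans y1.
  by rewrite ler_piMr.
rewrite mulrCA; apply: (@le_lt_trans _ _ ((1 - drift_ratio p) / 4)); last by lra.
rewrite ler_piMr //; first by lra.
by rewrite ler_pdivrMr // mul1r ler_nat.
Qed.

Lemma reach_sub n (A A' : pred (seq bool)) h : (forall h, A h -> A' h) ->
  reach p n A h <= reach p n A' h.
Proof.
move=> AA'; rewrite -[n in leRHS]addn0 -[leLHS]mulr1; apply: reach_trans => //.
by move=> h' /AA' A'h' _; rewrite /reach /= A'h'.
Qed.

Lemma reach_confined n b (g : pred (seq bool)) (A : pred (seq bool)) h :
  (0 < b)%N ->
  (forall w, confined b w -> pos w = b%:Z -> g w -> A (w ++ h)) ->
  value p n (exit b) (fun w => ((pos w == b%:Z) && g w)%:R) [::]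
    <= reach p n A h.
Proof.
move=> b0 gA.
apply: (@le_trans _ _ (value p n (exit b) (fun w => (A (w ++ h))%:R) [::])).
  apply: (@value_mono _ p p0 p1 (confined b)) => [//|h' s|w cw _].
    exact: confined_cons.
  case: eqP => //= wb; case: (boolP (g w)) => //= gw.
  by rewrite gA.
apply: le_trans (value_le_reach p0 p1 _ _ (fun w => A (w ++ h)) _) _.
by rewrite /reach -[h in leRHS]cat0s value_cat.
Qed.

Lemma reach_fresh h :
  exists n, (1 - drift_ratio p) / 2 <= reach p n (fun h => `[< fresh h >]) h.
Proof.
have u1 := drift_ratio_lt1 p_half p1; have u0 := drift_ratio_gt0 p_half p1.
have e0 : 0 < (1 - drift_ratio p) / 2 by lra.
(* [h] ends at [- size h] or higher and has visited nothing above [size h], so a climb by [b] ends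
   at a new maximum. *)
pose b := (size h).*2.+1; have [n hn] := value_exit_nil p_half p1 b e0.
exists n.
have h3 : (1 - drift_ratio p) / 2 <=
    value p n (exit b) (fun w => ((pos w == b%:Z) && predT w)%:R) [::].
  rewrite (@eq_value _ _ _ _ _ (fun w => (pos w == b%:Z)%:R)); last first.
    by move=> w; rewrite andbT.
  by move: hn; lra.
apply: le_trans h3 _; apply: reach_confined => // w cw wb _.
apply/asboolP/(fresh_cat _ cw wb) => // z zb; apply: visits_far.
by move: zb (pos_ge h); rewrite /b; lia.
Qed.

Lemma reach_tied r : exists2 c : R, 0 < c & forall N h, exists n,
  c <= reach p n (fun h => `[< exists2 L, (N <= L)%N & tied r L h >]) h.
Proof.
have u1 := drift_ratio_lt1 p_half p1; have u0 := drift_ratio_gt0 p_half p1.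
have [c c0 ctop] := exact_level; exists ((1 - drift_ratio p) / 2 * c ^+ r).
  by rewrite mulr_gt0 ?exprn_gt0 //; lra.
move=> N h; have [n hn] := reach_fresh h.
(* [L] exceeds the length of any history met when a fresh one is first reached, so no site is above
   [L] then; it also exceeds 1, as [tied_cat] requires. *)
have [L [b [m [NL cL]]]] := ctop (N + (n + size h).+2)%N.
have c1 : c <= 1.
  by apply: le_trans cL _; apply: value_le1 => // w; rewrite lern1 leq_b1.
have b0 : (0 < b)%N.
  rewrite lt0n; apply/eqP => b0; move: cL; rewrite b0 value_stop //= /high_exactly.
  by rewrite leNgt c0.
pose A j h' := `[< fresh h' /\ tied j L h' >].
have stepA j h' : A j h' -> c <= reach p m (A j.+1) h'.
  move=> /asboolP[fh' th']; apply: le_trans cL _; apply: reach_confined => //.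
  move=> w cw wb wtop; apply/asboolP; apply: tied_cat wtop => //.
  by lia.
have iterA k j h' : A j h' -> c ^+ k <= reach p (k * m) (A (j + k)%N) h'.
  elim: k j h' => [|k IH] j h' Ah'.
    by rewrite addn0 /reach /= Ah'.
  rewrite mulSn exprS -addSnnS.
  apply: (@le_trans _ _ (reach p m (A j.+1) h' * c ^+ k)).
    by rewrite ler_wpM2r ?exprn_ge0 ?(ltW c0) ?stepA.
  apply: reach_trans => //; first by rewrite exprn_ge0 // ltW.
    by rewrite exprn_ile1 // ltW.
  by move=> h'' Ah'' _; exact: IH.
exists (n + r * m)%N.
apply: (@le_trans _ _ (reach p (n + r * m) (A r) h)); last first.
  apply: reach_sub => h' /asboolP[_ tr]; apply/asboolP; exists L => //.
  by lia.
apply: (@le_trans _ _ (reach p n (fun h => `[< fresh h >]) h * c ^+ r)).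
  by rewrite ler_wpM2r ?exprn_ge0 // ltW.
apply: reach_trans => //; first by rewrite exprn_ge0 // ltW.
  by rewrite exprn_ile1 // ltW.
move=> h' /asboolP fh' sh'; apply: (iterA r 0%N); apply/asboolP; split=> //.
split; last by exists [::].
by move=> z; apply: leq_trans (visits_le_size z h') _; lia.
Qed.

End Ties.

(** * Uniformly reachable targets cannot be avoided *)

Section NeverReached.
Variables (R : archiRealFieldType) (p : R).
Hypotheses (p0 : 0 < p) (p1 : p < 1).

Fixpoint weight (h : seq bool) : R :=
  if h is b :: h' then (if b then p else 1 - p) * weight h' else 1.

Lemma weight_ge0 h : 0 <= weight h.
Proof.
by elim: h => //= b h IH; apply: mulr_ge0 => //; case: b; rewrite ?subr_ge0 ltW.
Qed.

(* [f h] stands for the probability that the walk begins with [h] and never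
   reaches [A]; each attempt multiplies the upper bound by [1 - c]. *)
Lemma never_reached (A : pred (seq bool)) (c : R) (f : seq bool -> R) :
  0 < c -> (forall h, exists n, c <= reach p n A h) ->
  (forall h, f h <= weight h) ->
  (forall h, f h <= f (true :: h) + f (false :: h)) ->
  (forall h, A h -> f h <= 0) -> f [::] <= 0.
Proof.
move=> c0 cA fw f_split fA.
have c1 : c <= 1.
  by have [n /le_trans] := cA [::]; apply; exact: value_le1.
(* Splitting [f] over the next [n] steps, only the continuations that avoid [A] contribute. *)
have attempt t n h : 0 <= t -> (forall h, f h <= t * weight h) ->
    f h <= t * weight h * (1 - reach p n A h).
  move=> t0 ft; elim: n h => [|n IH] h; rewrite /reach /=; case: ifP => Ah.
  - by rewrite subrr mulr0 fA.
  - by rewrite subr0 mulr1.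
  - by rewrite subrr mulr0 fA.
  apply: (le_trans (f_split h)); apply: (le_trans (lerD (IH _) (IH _))).
  by rewrite /reach /= le_eqVlt; apply/orP; left; apply/eqP; ring.
have iter k h : f h <= (1 - c) ^+ k * weight h.
  elim: k h => [|k IH] h; first by rewrite mul1r.
  have [n cn] := cA h.
  have t0 : 0 <= (1 - c) ^+ k by rewrite exprn_ge0 // subr_ge0.
  apply: le_trans (attempt _ n h t0 IH) _; rewrite exprSr mulrAC.
  by rewrite ler_wpM2r ?weight_ge0 // ler_wpM2l // lerD2l lerN2.
rewrite leNgt; apply/negP => f0.
have [|k] := @expr_le_eps R c (f [::] / 2) c0 c1; first by rewrite divr_gt0.
have := iter k [::]; rewrite mulr1 => /le_trans /[apply].
by move: f0; lra.
Qed.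

End NeverReached.

(** * Local times and favorite sites along one path *)

Fixpoint hist (b : nat -> bool) (n : nat) : seq bool :=
  if n is m.+1 then b m :: hist b m else [::].

Lemma local_timeS (R : realType) (x : nat -> R) z n :
  local_time x z n.+1 = ((walk x n.+1 == z%:~R) + local_time x z n)%N.
Proof.
rewrite /local_time (_ : iota 1 n.+1 = iota 1 n ++ [:: n.+1]).
  by rewrite count_cat /= addn0 addnC.
by rewrite -[n.+1 in LHS]addn1 iotaD add1n.
Qed.

Lemma local_time_homo (R : realType) (x : nat -> R) z :
  {homo local_time x z : m n / (m <= n)%N}.
Proof.
apply: homo_leq => [//|m k l /leq_trans|n]; first exact.
by rewrite local_timeS leq_addl.
Qed.

Lemma local_time_le (R : realType) (x : nat -> R) z n : (local_time x z n <= n)%N.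
Proof. by rewrite (leq_trans (count_size _ _)) // size_iota. Qed.

Lemma local_time_max (R : realType) (x : nat -> R) z n :
  (local_time x z n <= max_local_time x n)%N.
Proof.
by rewrite /max_local_time; case: ex_maxnP => m _; apply; apply/asboolP; exists z.
Qed.

Lemma max_local_time_ex (R : realType) (x : nat -> R) n :
  exists z, local_time x z n = max_local_time x n.
Proof. by rewrite /max_local_time; case: ex_maxnP => m /asboolP. Qed.

Lemma favoriteE (R : realType) (x : nat -> R) n z :
  favorite_sites x n z <-> forall y, (local_time x y n <= local_time x z n)%N.
Proof.
rewrite /favorite_sites /=; split => [-> y|zmax]; first exact: local_time_max.
have [y yE] := max_local_time_ex x n.
by apply/eqP; rewrite eqn_leq local_time_max -yE zmax.
Qed.

(* Only one site gains a visit at each step, so at the first time when [r]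
   sites have local time at least [L] there are exactly [r] of them. *)
Lemma exactly_r_favorites (R : realType) (x : nat -> R) (r L n : nat) (s : seq int) :
  (0 < r)%N -> (0 < L)%N -> uniq s -> size s = r ->
  {in s, forall z, local_time x z n = L} ->
  (forall z, (local_time x z n <= L)%N) ->
  exists2 m, (L <= m)%N & favorite_sites x m #= `I_r.
Proof.
move=> r0 L0 us ss sL maxL.
pose W m := `[< exists s : seq int, [/\ uniq s, size s = r &
  {in s, forall z, L <= local_time x z m}%N] >].
have exW : exists m, W m.
  by exists n; apply/asboolP; exists s; split => // z /sL ->.
case: (ex_minnP exW) => m /asboolP[t [ut st tL]] m_min.
have mn : (m <= n)%N.
  by apply: m_min; apply/asboolP; exists s; split => // z /sL ->.
have [z zt] : exists z, z \in t.
  case: t {ut tL} st => [st|z t _]; first by move: r0; rewrite -st.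
  by exists z; exact: mem_head.
have Lm : (L <= m)%N by apply: leq_trans (tL _ zt) (local_time_le _ _ _).
exists m => //.
have lm y : (local_time x y m <= L)%N.
  by apply: leq_trans (maxL y); exact: local_time_homo.
have -> : favorite_sites x m = [set` [fset y in t]%fset].
  apply/seteqP; split => y /=; rewrite favoriteE ?inE; last first.
    by move=> /tL yL y'; exact: leq_trans (lm y') yL.
  move=> ymax; have yL : (L <= local_time x y m)%N.
    by apply: leq_trans (ymax z); exact: tL.
  apply: contrapT => /negP yt.
  case: m => [|m] in Lm m_min tL yL {mn lm ymax} *; first by move: L0 Lm; lia.
  (* With a further favorite [y], [r + 1] sites would have level [L]. Without the one just visited,
     [r] of them had it one step earlier, against minimality. *)
  suff : W m by move/m_min; rewrite ltnn.
  pose visited := fun v : int => walk x m.+1 == v%:~R.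
  have keep v : (L <= local_time x v m.+1)%N -> ~~ visited v ->
      (L <= local_time x v m)%N.
    by move=> Lv /negPf nv; move: Lv; rewrite local_timeS -/(visited v) nv.
  have ytL : {in y :: t, forall v, (L <= local_time x v m.+1)%N}.
    by move=> v; rewrite inE => /orP[/eqP ->|/tL].
  have uyt : uniq (y :: t) by rewrite /= yt.
  case: (boolP (has visited (y :: t))) => [/hasP[v vyt vv]|/hasPn novisit].
    apply/asboolP; exists (rem v (y :: t)); split; first exact: rem_uniq.
      by rewrite size_rem //= st.
    move=> v'; rewrite mem_rem_uniq // inE => /andP[v'v /ytL v'L].
    apply: keep => //; apply: contra v'v => /eqP wv'.
    by move: vv; rewrite /visited wv' eqr_int.
  apply/asboolP; exists t; split => // v vt; apply: keep; first exact: tL.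
  by apply: novisit; rewrite inE vt orbT.
by apply/card_eq_fsetP; rewrite card_fseq undup_id.
Qed.

Lemma infinite_natP (A : set nat) :
  infinite_set A <-> forall N, exists2 n, (N <= n)%N & A n.
Proof.
split=> [infA N|Ainf /finite_fsetP[B AB]].
  apply: contrapT => noA; apply: infA; apply: (@sub_finite_set _ _ `I_N) => //.
  move=> n An /=; rewrite ltnNge; apply/negP => Nn; apply: noA.
  by exists n.
have [n Bn An] := Ainf (\max_(i <- B) i).+1.
have nB : n \in B by move: An; rewrite AB.
have := @leq_bigmax_seq nat (enum_fset B) xpredT (fun i : nat => i) n nB isT.
by rewrite leqNgt Bn.
Qed.

(** * Measurability of the events *)

Section Measurability.
Context d (T : measurableType d).

Lemma measurable_cstP (Q : Prop) : measurable [set _ : T | Q].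
Proof.
have [q|nq] := pselect Q.
  by rewrite (_ : [set _ | _] = setT) //; apply/seteqP; split.
by rewrite (_ : [set _ | _] = set0) //; apply/seteqP; split.
Qed.

Lemma measurable_hist (b : nat -> T -> bool) n (Q : seq bool -> Prop) :
  (forall k, measurable [set w | b k w]) ->
  measurable [set w | Q (hist (b ^~ w) n)].
Proof.
move=> mb; elim: n Q => [|n IH] Q /=; first exact: measurable_cstP.
rewrite [D in measurable D](_ : _ =
    ([set w | b n w] `&` [set w | Q (true :: hist (b ^~ w) n)]) `|`
    (~` [set w | b n w] `&` [set w | Q (false :: hist (b ^~ w) n)])).
  apply: measurableU; apply: measurableI; first exact: mb.
  - exact: (IH (fun h => Q (true :: h))).
  - exact/measurableC/mb.
  - exact: (IH (fun h => Q (false :: h))).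
apply/seteqP; split => w /=.
  by case: (boolP (b n w)) => [bw Qw|/negP bw Qw]; [left|right].
by case=> -[]; [move=> ->|move=> /negP/negPf ->].
Qed.

Lemma measurable_forall (J : countType) (F : J -> T -> Prop) :
  (forall i, measurable [set w | F i w]) -> measurable [set w | forall i, F i w].
Proof.
move=> mF; rewrite [D in measurable D](_ : _ = ~` \bigcup_i ~` [set w | F i w]).
  apply/measurableC/countable_bigcupT_measurable => [|i]; last exact/measurableC.
  exact: countableP.
rewrite setC_bigcup; apply/seteqP; split => w /= Fw i.
  by move=> _; rewrite setCK; exact: Fw.
by have := Fw i I; rewrite setCK.
Qed.

Lemma measurable_exists (J : countType) (F : J -> T -> Prop) :
  (forall i, measurable [set w | F i w]) -> measurable [set w | exists i, F i w].
Proof.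
move=> mF; rewrite [D in measurable D](_ : _ = \bigcup_i [set w | F i w]).
  exact: countable_bigcupT_measurable.
by apply/seteqP; split => w /= [i]; exists i.
Qed.

End Measurability.

Section Walk.
Context (R : realType) d (T : measurableType d) (P : probability T R).
Variable X : nat -> {RV P >-> R}.

Let mwalk n (z : R) : measurable [set w | walk (fun k => X k w) n == z].
Proof.
rewrite [X in measurable X](_ : _ =
  (fun w => \sum_(0 <= k < n) X k w) @^-1` [set z]); last first.
  by apply/seteqP; split => w /= /eqP.
rewrite -[X in measurable X]setTI.
have : measurable_fun setT (fun w => \sum_(0 <= k < n) X k w).
  by apply: measurable_sum => k; exact: measurable_funP.
by apply => //; exact: measurable_set1.
Qed.

(** Visits to [z] are recorded as a boolean history, so that [measurable_hist] applies. *)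
Lemma local_time_hist (x : nat -> R) z n :
  local_time x z n = count id (hist (fun k => walk x k.+1 == z%:~R) n).
Proof. by elim: n => // n IH; rewrite local_timeS IH. Qed.

Lemma measurable_local_time z n (Q : nat -> Prop) :
  measurable [set w | Q (local_time (fun k => X k w) z n)].
Proof.
under eq_set do rewrite local_time_hist.
apply: (measurable_hist (b := fun k w => walk (fun k => X k w) k.+1 == z%:~R)
  n (fun h => Q (count id h))) => k.
exact: mwalk.
Qed.

Lemma measurable_favorite n z :
  measurable [set w | favorite_sites (fun k => X k w) n z].
Proof.
under eq_set do rewrite (propext (favoriteE _ _ _)).
apply: measurable_forall => y.
rewrite [D in measurable D](_ : _ = [set w | exists i,
    local_time (fun k => X k w) z n = i /\
    (local_time (fun k => X k w) y n <= i)%N]).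
  by apply: measurable_exists => i; apply: measurableI;
    [exact: (measurable_local_time _ _ (fun j => j = i))
    |exact: (measurable_local_time _ _ (fun j => (j <= i)%N))].
apply/seteqP; split => w /=; last by case=> i [<-].
by move=> yz; exists (local_time (fun k => X k w) z n).
Qed.

Lemma measurable_infinitely_often r :
  measurable [set w | infinite_set [set n : nat |
    favorite_sites (fun k => X k w) n #= `I_r]].
Proof.
under eq_set do rewrite (propext (infinite_natP _)).
apply: measurable_forall => N.
rewrite [D in measurable D](_ : _ = [set w | exists n, (N <= n)%N /\
    favorite_sites (fun k => X k w) n #= `I_r]); last first.
  by apply/seteqP; split => w /= [n]; [move=> ? ?|case=> ? ?]; exists n.
apply: measurable_exists => n; apply: measurableI; first exact: measurable_cstP.
(* Finite sets of integers are countably many, so the cardinality condition becomes a countable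
   union. *)
rewrite [D in measurable D](_ : _ = [set w |
    exists F : {fset int}, #|` F|%fset = r /\
    forall z, favorite_sites (fun k => X k w) n z <-> z \in F]).
  apply: measurable_exists => F; apply: measurableI; first exact: measurable_cstP.
  apply: measurable_forall => z; have [zF|zF] := boolP (z \in F).
    rewrite [D in measurable D](_ : _ =
        [set w | favorite_sites (fun k => X k w) n z]).
      exact: measurable_favorite.
    by apply/seteqP; split => w /=; [case=> _; apply|split].
  rewrite [D in measurable D](_ : _ =
      ~` [set w | favorite_sites (fun k => X k w) n z]).
    exact/measurableC/measurable_favorite.
  by apply/seteqP; split => w /=; [case=> wF _ /wF|split].
apply/seteqP; split => w /=.
  move=> Kr; exists (fset_set (favorite_sites (fun k => X k w) n)); split.
    exact: card_fset_set.
  move=> z; rewrite in_fset_set; last by apply/finite_setP; exists r.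
  by split=> [/mem_set|/set_mem].
case=> F [Fr FE]; rewrite (_ : favorite_sites _ n = [set` F]).
  exact/card_eq_fsetP.
by apply/seteqP; split => z /FE.
Qed.

End Walk.

(** * The law of the coin tosses read off the steps *)

Section Coins.
Context (R : realType) d (T : measurableType d) (P : probability T R).
Variables (X : nat -> {RV P >-> R}) (e a : R).
Hypotheses (a0 : 0 < a) (a1 : a < 1).
Hypothesis Xindep : mutually_independent P X.
Hypothesis Xe : forall k, P [set w | X k w = e] = a%:E.

Definition coins (w : T) : nat -> bool := fun k => X k w == e.

(** Taking the complement of [e] instead of [- e] makes the two sides a partition on every path, not
    just almost surely. *)
Definition side (b : bool) : set R := if b then [set e] else ~` [set e].

Lemma measurable_side b : measurable (side b).
Proof. by case: b => /=; [|apply: measurableC]; exact: measurable_set1. Qed.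

Lemma measurable_coins k : measurable [set w | coins w k].
Proof.
rewrite [D in measurable D](_ : _ = X k @^-1` side true); last first.
  by apply/seteqP; split => w /= /eqP.
rewrite -[D in measurable D]setTI; apply: measurable_funP => //.
exact: measurable_side.
Qed.

Lemma side_prob k b : P (X k @^-1` side b) = (if b then a else 1 - a)%:E.
Proof.
case: b; first exact: Xe.
rewrite [side false]/= -preimage_setC probability_setC.
  by rewrite [X in (1 - X)%E](_ : _ = a%:E) // -(Xe k).
by rewrite -[D in measurable D]setTI; apply: measurable_funP.
Qed.

Lemma hist_eq (b : nat -> bool) h :
  hist b (size h) = h <-> forall i, (i < size h)%N -> b i = nth true (rev h) i.
Proof.
elim: h => [|c h IH] //=; rewrite rev_cons; split=> [[bc /IH hE] i|bE].
  rewrite ltnS leq_eqVlt nth_rcons size_rev => /orP[/eqP ->|ih].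
    by rewrite ltnn eqxx.
  by rewrite ih hE.
congr (_ :: _).
  by rewrite bE // nth_rcons size_rev ltnn eqxx.
by apply/IH => i ih; rewrite bE ?ltnS 1?ltnW // nth_rcons size_rev ih.
Qed.

Definition cylinder (h : seq bool) : set T := [set w | hist (coins w) (size h) = h].

Lemma cylinder_prob h : P (cylinder h) = (weight a h)%:E.
Proof.
pose J := [fset k in iota 0 (size h)]%fset.
pose B i := side (nth true (rev h) i).
have -> : cylinder h = \bigcap_(i in [set` J]) (X i @^-1` B i).
  apply/seteqP; split => w /=; rewrite /cylinder /= hist_eq => hE i.
    rewrite /= !inE mem_iota add0n => /hE; rewrite /coins /B /side /=.
    by case: nth => /eqP.
  move=> ih; have /= := hE i; rewrite !inE mem_iota add0n => /(_ ih).
  rewrite /coins /B /side; case: nth => /= [->|]; first by rewrite eqxx.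
  by move=> /eqP/negPf.
rewrite Xindep => [|i]; last exact: measurable_side.
rewrite (perm_big (iota 0 (size h))) /=; last first.
  apply: uniq_perm; rewrite ?fset_uniq ?iota_uniq // => i.
  by rewrite !inE.
under eq_bigr do rewrite side_prob.
rewrite {J B}; elim: h => [|b h IH]; first by rewrite big_nil.
rewrite [size _]/= -addn1 iotaD big_cat /= big_seq1 add0n rev_cons.
rewrite nth_rcons size_rev ltnn eqxx EFinM muleC -IH; congr (_ * _)%E.
rewrite big_seq [RHS]big_seq; apply: eq_bigr => i; rewrite mem_iota => /= ih.
by rewrite nth_rcons size_rev ih.
Qed.

Definition never (A : pred (seq bool)) : set T :=
  [set w | forall n, ~ A (hist (coins w) n)].

Lemma measurable_never A : measurable (never A).
Proof.
apply: measurable_forall => n.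
exact: (measurable_hist n (fun h => ~ A h) measurable_coins).
Qed.

(** [never_reached] applies to the probability of starting with [h] and avoiding [A]: it is at most
    that of the cylinder and splits according to the next coin. *)
Lemma never_prob0 (A : pred (seq bool)) (c : R) : 0 < c ->
  (forall h, exists n, c <= reach a n A h) -> P (never A) = 0%E.
Proof.
move=> c0 cA; pose f h := fine (P (cylinder h `&` never A)).
have mcyl h : measurable (cylinder h).
  exact: (measurable_hist (size h) (fun h' => h' = h) measurable_coins).
have mI h : measurable (cylinder h `&` never A).
  exact: measurableI (mcyl h) (measurable_never A).
have fE h : (f h)%:E = P (cylinder h `&` never A).
  by rewrite fineK // fin_num_measure.
have f0 : f [::] <= 0.
  apply: (@never_reached _ a a0 a1 A c) => // h.
  - rewrite -lee_fin fE -cylinder_prob; apply: le_measure; rewrite ?inE //.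
  - rewrite -lee_fin EFinD !fE; apply: le_trans (measureU2 _ (mI _) (mI _)).
    apply: le_measure; rewrite ?inE //; first exact: measurableU.
    move=> w [hw nw]; rewrite -setIUl; split; last exact: nw.
    case E : (coins w (size h)); [left|right]; rewrite /cylinder /= in hw *;
      by rewrite E hw.
  - move=> Ah; rewrite -lee_fin fE (_ : _ `&` _ = set0) ?measure0 //.
    by apply/seteqP; split => // w [hw /(_ (size h))]; rewrite hw; apply.
apply/eqP; rewrite eq_le measure_ge0 andbT.
have -> : never A = cylinder [::] `&` never A.
  by rewrite (_ : cylinder [::] = setT) ?setTI //; apply/seteqP; split.
by rewrite -fE lee_fin.
Qed.

End Coins.

(** * From coin tosses back to the walk *)

Lemma walk_hist (R : realType) (x : nat -> R) (s : int) n :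
  (forall k, x k = s%:~R \/ x k = - s%:~R) ->
  walk x n = (s * pos (hist (fun k => x k == s%:~R) n))%:~R.
Proof.
move=> xs; elim: n => [|n IH]; first by rewrite /walk big_geq // mulr0.
rewrite /walk big_nat_recr // -/(walk x n) IH /= mulrDr intrD addrC; congr (_ + _).
case: eqP => [->|/eqP xn]; first by rewrite mulr1.
by case: (xs n) xn => -> => [|_]; [rewrite eqxx|rewrite mulrN1 intrN].
Qed.

Lemma local_time_visits (R : realType) (x : nat -> R) (s : int) z n : s * s = 1 ->
  (forall k, x k = s%:~R \/ x k = - s%:~R) ->
  local_time x z n = visits (s * z) (hist (fun k => x k == s%:~R) n).
Proof.
move=> s2 xs; elim: n => // n IH; rewrite local_timeS IH /=; congr (_ + _)%N.
rewrite (walk_hist _ xs) eqr_int /=; congr nat_of_bool.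
by apply/eqP/eqP => [<-|->]; rewrite mulrA s2 mul1r.
Qed.

(** [s] is the direction of the drift, 1 or -1. A coin is true for a step along [s], and reflecting
    sites by [s] reduces both directions to a drift to the right. *)
Lemma biased_walk_favorites (R : realType) (d : measure_display)
    (T : measurableType d)
    (P : probability T R) (X : nat -> {RV P >-> R}) (s : int) (a : R) (r : nat) :
  s * s = 1 -> 1 < a + a -> a < 1 -> mutually_independent P X ->
  (forall k, P [set w | X k w = s%:~R] = a%:E) ->
  (forall k, P [set w | X k w = - s%:~R] = (1 - a)%:E) -> (1 <= r)%N ->
  P [set w | infinite_set [set n : nat |
      favorite_sites (fun k => X k w) n #= `I_r]] = 1%E.
Proof.
move=> s2 a_half a1 Xindep Xs XNs r1.
have a0 : 0 < a by lra.
set S := [set w | _]; have mS : measurable S by exact: measurable_infinitely_often.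
suff : P (~` S) = 0%E.
  rewrite probability_setC // => /eqP; rewrite sube_eq ?fin_num_measure //.
  by rewrite add0e => /eqP <-.
have [c c0 ctied] := reach_tied a_half a1 r.
pose A N h := `[< exists2 L, (N <= L)%N & tied r L h >].
pose pm k := [set w | X k w = s%:~R] `|` [set w | X k w = - s%:~R].
have mX k (y : R) : measurable [set w | X k w = y].
  rewrite -[D in measurable D]setTI -[[set w | _]]/(X k @^-1` [set y]).
  by apply: measurable_funP => //; exact: measurable_set1.
have s0 : s%:~R != 0 :> R.
  by rewrite intr_eq0; apply/eqP => s0; rewrite s0 in s2.
have pm1 k : P (~` pm k) = 0%E.
  have PU : P (pm k) =
      (P [set w | X k w = s%:~R] + P [set w | X k w = (- s%:~R)%R])%E.
    apply: measureU => //; apply/seteqP; split => // w [/= ->] /eqP.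
    by rewrite -subr_eq0 opprK -mulr2n mulrn_eq0 /= (negPf s0).
  rewrite probability_setC; last exact: measurableU.
  by rewrite PU Xs XNs -EFinD subrKC subrr.
apply: measure_negligible; first exact: measurableC.
have mpm k : measurable (~` pm k) by apply/measurableC/measurableU.
have N1 : P.-negligible (\bigcup_k ~` pm k).
  by apply: negligible_bigcup => k; exists (~` pm k); split;
    [exact: mpm | exact: pm1 | exact: subset_refl].
(* The shift to [N.+1] makes the level of the tie positive, as [exactly_r_favorites] requires. *)
have N2 : P.-negligible (\bigcup_N never X s%:~R (A N.+1)).
  apply: negligible_bigcup => N; exists (never X s%:~R (A N.+1)).
  split=> //; first exact: measurable_never.
  by apply: (never_prob0 a0 a1 Xindep Xs c0) => h; exact: ctied.
apply: negligibleS (negligibleU N1 N2) => w nSw.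
apply: contrapT => nw; apply: nSw; rewrite /S /=; apply/infinite_natP => N.
have xs k : X k w = s%:~R \/ X k w = - s%:~R.
  by apply: contrapT => nk; apply: nw; left; exists k.
have [n [L NL [maxL [t [ut st tL]]]]] :
    exists n, exists2 L, (N.+1 <= L)%N & tied r L (hist (coins X s%:~R w) n).
  apply: contrapT => non; apply: nw; right; exists N => // n /asboolP An.
  by apply: non; exists n.
have lt z : local_time (fun k => X k w) z n =
    visits (s * z) (hist (coins X s%:~R w) n).
  exact: local_time_visits.
have sK : involutive (fun z : int => s * z) by move=> z; rewrite mulrA s2 mul1r.
have [m Lm Km] : exists2 m, (L <= m)%N &
    favorite_sites (fun k => X k w) m #= `I_r.
  apply: (@exactly_r_favorites _ _ r L n (map (fun z : int => s * z) t)) => //.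
  - by lia.
  - by rewrite map_inj_uniq //; exact: inv_inj.
  - by rewrite size_map.
  - by move=> _ /mapP[z zt ->]; rewrite lt sK tL.
  - by move=> z; rewrite lt.
by exists m => //; lia.
Qed.

Theorem theorem1p1 (R : realType) (d : measure_display) (T : measurableType d)
    (P : probability T R) (p q : R) (X : nat -> {RV P >-> R})
    (p01 : 0 < p < 1) (qE : q = 1 - p) (pq : p <> q)
    (Xindep : mutually_independent P X)
    (Xp : forall k, P [set w | X k w = 1] = p%:E)
    (Xq : forall k, P [set w | X k w = -1] = q%:E)
    (r : nat) (r1 : (1 <= r)%N) :
  P [set w | infinite_set [set n : nat |
      favorite_sites (fun k => X k w) n #= `I_r]] = 1%E.
Proof.
have /andP[p0 p1] := p01.
have [qp|pq'|//] := ltgtP q p; last by move=> qp; case: pq.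
- apply: (@biased_walk_favorites _ _ _ _ _ 1 p) => //; first by lra.
  by rewrite -qE.
- apply: (@biased_walk_favorites _ _ _ _ _ (-1) q) => //; [lra|lra|].
  by move=> k; rewrite mulrN1z opprK (_ : 1 - q = p); [exact: Xp|lra].
Qed.
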